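(* Let $l\ge 2$ be an integer, let $p$ be a prime, and let $t_0$ be such that $l\in G_{t_0}$. Let $\mathbf{s}=(s_1,\dots,s_l)$ be a sequence of positive integers and put $m=\min\{s_i:1\le i\le l\}$ and $|\mathbf{s}|=s_1+\dots+s_l$. For each positive integer $t$ set $f(\mathbf{s},p;t)=\min\{-v_p(H(\mathbf{s};n)): n\in G_t\}$. If there is $\tau>t_0$ such that $$f(\mathbf{s},p;\tau)>(|\mathbf{s}|-m)(\tau-1)-m,$$ then $J(\mathbf{s}|p)$ is finite.
   Context: For a prime $p$, $v_p$ is the $p$-adic valuation on $\mathbb{Q}$ (with $v_p(p)=1$), $G_0=\{0\}$ and $G_t=\{n\in\mathbb{Z}: p^{t-1}\le n<p^t\}$ for $t\ge 1$. For a sequence $\mathbf{s}=(s_1,\dots,s_l)$ of positive integers and an integer $n\ge 0$, the multiple harmonic sum is $H(\mathbf{s};n)=\sum_{1\le k_1<\dots<k_l\le n} k_1^{-s_1}\cdots k_l^{-s_l}$ (so it is $0$ for $0\le n<l$). For $n\ge l$ write $H(\mathbf{s};n)=a(\mathbf{s};n)/b(\mathbf{s};n)$ in lowest terms with positive integers $a,b$; set $a(\mathbf{s};0)=0$, $b(\mathbf{s};0)=1$. The $p$-divisible set is $J(\mathbf{s}|p)=\{0\}\cup\{n\ge l: a(\mathbf{s};n)\equiv 0\pmod p\}$. *)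

(* Defs.v *)
From mathcomp Require Import all_boot all_order all_algebra.
From mathcomp Require Import classical_sets cardinality constructive_ereal.
Set Implicit Arguments.
Unset Strict Implicit.
Unset Printing Implicit Defensive.
Import Order.TTheory GRing.Theory Num.Theory.
Local Open Scope ring_scope.

(* The value at 0 is +oo, so -vp can take the value -oo. *)
Definition vp (p : nat) (q : rat) : \bar int :=
  if q == 0 then +oo%E
  else ((logn p `|numq q|)%:Z - (logn p `|denq q|)%:Z)%:E.

Definition G (p t : nat) : pred nat :=
  if t is t'.+1 then [pred n | (p ^ t' <= n < p ^ t'.+1)%N] else pred1 0%N.

(* k ranges over the strictly increasing maps from 'I_l to {1, ..., n}. *)
Definition H (l : nat) (s : l.-tuple nat) (n : nat) : rat :=
  \sum_(k : {ffun 'I_l -> 'I_n.+1} |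
          [forall i : 'I_l, (0 < k i)%N] &&
          [forall i : 'I_l, forall j : 'I_l, (i < j)%N ==> (k i < k j)%N])
    \prod_(i < l) ((k i)%:R ^- tnth s i).

(* For n >= l the sum is positive, hence so is its reduced numerator; for
   n = 0 and l > 0 one gets numerator 0 and denominator 1. *)
Definition a (l : nat) (s : l.-tuple nat) (n : nat) : int := numq (H s n).

Definition J (l : nat) (s : l.-tuple nat) (p : nat) : set nat :=
  [set n : nat | n = 0%N \/ (l <= n)%N /\ (p%:Z %| a s n)%Z]%classic.

Definition weight (l : nat) (s : l.-tuple nat) : nat := (\sum_(i < l) tnth s i)%N.

Definition smin (l : nat) (s : l.-tuple nat) : nat :=
  (\big[minn/head 0 s]_(i < l) tnth s i)%N.

(* Every element of G p t is below p ^ t; for p > 1 the set G p t is nonempty,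
   so the default value +oo does not affect the minimum. *)
Definition f (l : nat) (s : l.-tuple nat) (p t : nat) : \bar int :=
  \big[Order.min/+oo%E]_(n < p ^ t | G p t n) (- vp p (H s n))%E.

(* Main.v *)
Require Import Defs.
From HB Require Import structures.
From mathcomp Require Import all_boot all_order all_algebra.
From mathcomp Require Import classical_sets cardinality constructive_ereal.
Import Order.TTheory GRing.Theory Num.Theory.
Local Open Scope ring_scope.

(** Call a rational p-local when it lies in the localization of the integers
    at p.  A lower bound on -v_p (H n) says that some power of p (possibly of
    negative exponent) times H n is not p-local, so all the valuation arguments
    become membership arguments in a subring of the rationals.

    Write W for the weight and m for the least exponent.  Split H (n) according
    to whether every k_i is divisible by p.  Dividing the divisible tuples by p
    gives p^-W H (n %/ p) exactly.  In any other tuple some k_j is prime to p,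
    and if n < p^(t+1) every other k_i has valuation at most t; hence the term
    has a denominator whose p-part divides p^((W - s_j) t), so that
    p^((W - m) t) clears it.  Therefore
      p^((W - m) t) H (n)  and  p^((W - m) t - W) H (n %/ p)
    differ by a p-local number ([H_sub_quotient_plocal]).  Since
    (W - m) t - W = (W - m) (t - 1) - m is exactly the exponent of the
    hypothesis at level t, and n %/ p lies one level below n, failure of
    p-locality passes from level t to level t + 1, with p^m to spare
    ([H_not_plocal_step]).  By induction it holds at every level t above tau.
    There (W - m) (t - 1) is a nonnegative exponent for which p-locality already
    fails without the factor p^-m, so H (n) itself is not p-local:
    p divides its reduced denominator and hence not its numerator.  Thus J
    contains only numbers below p^tau. *)

(** * The localization of the integers at p *)

Definition plocal (p : nat) : {pred rat} := fun x => coprime p `|denq x|.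

(** Any denominator prime to p will do, not only the reduced one: this is
    what makes closure under the ring operations immediate. *)
Lemma plocalP (p : nat) (x : rat) :
  reflect (exists2 d : nat, coprime p d & d%:R * x \is a Num.int)
          (x \in plocal p).
Proof.
apply: (iffP idP) => [xp | [d pd /intrP[z dx]]].
  exists `|denq x|%N => //.
  by rewrite pmulrn absz_denq mulrC -numqE intr_int.
have eqz : numq x * d%:Z = z * denq x.
  apply: (@intr_inj rat); rewrite !rmorphM /= numqE -dx -!pmulrn.
  by rewrite mulrC mulrA.
have: (`|denq x| %| `|numq x| * d)%N.
  by rewrite -[d in (_ * d)%N]/(`|d%:Z|%N) -abszM eqz abszM dvdn_mull.
rewrite Gauss_dvdr; last by rewrite coprime_sym coprime_num_den.
by move=> /coprime_dvdr; apply.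
Qed.

Lemma plocal_subring_closed (p : nat) : GRing.subring_closed (plocal p).
Proof.
split.
- by apply/plocalP; exists 1%N; rewrite ?coprimen1 // mulr1 rpred1.
- move=> x y /plocalP[d pd dx] /plocalP[e pe ey]; apply/plocalP.
  exists (d * e)%N; first by rewrite coprimeMr pd pe.
  have -> : (d * e)%:R * (x - y) = e%:R * (d%:R * x) - d%:R * (e%:R * y).
    by rewrite natrM mulrBr !mulrA [e%:R * d%:R]mulrC.
  by rewrite rpredB // rpredM ?natr_int.
- move=> x y /plocalP[d pd dx] /plocalP[e pe ey]; apply/plocalP.
  exists (d * e)%N; first by rewrite coprimeMr pd pe.
  by rewrite natrM mulrACA rpredM.
Qed.

HB.instance Definition _ (p : nat) :=
  GRing.isSubringClosed.Build rat (plocal p) (plocal_subring_closed p).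

Lemma coprime_plocalV (p k : nat) : coprime p k -> k%:R^-1 \in plocal p.
Proof.
move=> pk; apply/plocalP; exists k => //.
have [-> | k0] := eqVneq (k%:R : rat) 0; first by rewrite mul0r rpred0.
by rewrite mulfV // rpred1.
Qed.

Lemma pexp_div_plocal (p t k : nat) (hp : prime p) :
  (0 < k < p ^ t.+1)%N -> (p ^ t)%:R / k%:R \in plocal p.
Proof.
move=> /andP[k0 kp]; have [k' pk' kE] := pfactor_coprime hp k0.
have k'0 : (0 < k')%N by case: k' kE {pk'} k0 => [->|].
have vt : (logn p k <= t)%N.
  rewrite -ltnS -(ltn_exp2l _ _ (prime_gt1 hp)); apply: leq_ltn_trans kp.
  by rewrite dvdn_leq // pfactor_dvdnn.
have -> : (p ^ t)%:R / k%:R = (p ^ (t - logn p k))%:R / k'%:R :> rat.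
  have k'n : (k'%:R : rat) != 0 by rewrite pnatr_eq0 -lt0n.
  have kn : (k%:R : rat) != 0 by rewrite pnatr_eq0 -lt0n.
  apply/eqP; rewrite eqr_div // -!natrM eqr_nat; apply/eqP.
  by rewrite {2}kE mulnCA -expnD subnK // mulnC.
by rewrite rpredM ?rpred_nat ?coprime_plocalV.
Qed.

(** The bridge to [vp]: c1 - c2 plays the part of an integer exponent. *)
Lemma plocal_vp_le (p c1 c2 : nat) (x : rat) (hp : prime p) :
  (p ^ c1)%:R / (p ^ c2)%:R * x \in plocal p ->
  (- vp p x <= (c1%:Z - c2%:Z)%:E)%E.
Proof.
move=> /plocalP[d pd /intrP[z zE]]; rewrite /vp.
have [_|x0] := eqVneq x 0; first by rewrite leNye.
have pn c : ((p ^ c)%:R : rat) != 0.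
  by rewrite pnatr_eq0 -lt0n expn_gt0 prime_gt0.
have eqz : d%:Z * (p ^ c1)%:Z * numq x = z * denq x * (p ^ c2)%:Z.
  apply: (@intr_inj rat); rewrite !rmorphM /= numqE -zE -!pmulrn.
  rewrite !mulrA [RHS]mulrAC; congr (_ * _).
  by rewrite [RHS]mulrAC mulfVK.
have := congr1 absz eqz; rewrite !abszM => eqn.
have d0 : (0 < d)%N.
  by case: d pd {zE eqz eqn} => //; rewrite prime_coprime // dvdn0.
have nx : (0 < `|numq x|)%N by rewrite absz_gt0 numq_eq0.
have dx : (0 < `|denq x|)%N by rewrite absz_gt0 denq_neq0.
have pp c : (0 < p ^ c)%N by rewrite expn_gt0 prime_gt0.
have z0 : (0 < `|z|)%N.
  have : (0 < `|d%:Z| * `|(p ^ c1)%:Z| * `|numq x|)%N by rewrite !muln_gt0 d0 pp.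
  by rewrite eqn !muln_gt0 => /andP[/andP[]].
have := congr1 (logn p) eqn.
rewrite !lognM ?muln_gt0 ?d0 ?z0 ?dx ?pp //= !pfactorK // logn_coprime //.
rewrite add0n => lE.
rewrite lee_fin opprB lerBlDr addrAC lerBrDr -!PoszD lez_nat.
by rewrite lE -addnA leq_addl.
Qed.

(** * One level of the recursion on multiple harmonic sums *)

Lemma smin_le (l : nat) (s : l.-tuple nat) (j : 'I_l) :
  (smin s <= tnth s j)%N.
Proof. by rewrite /smin -minEnat -leEnat bigmin_le. Qed.

Lemma tnth_le_weight (l : nat) (s : l.-tuple nat) (j : 'I_l) :
  (tnth s j <= weight s)%N.
Proof. by rewrite /weight (bigD1 j) //= leq_addr. Qed.

(** The index k_j prime to p needs no power of p, and each other k_i needs at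
    most p^(t s_i); the worst case is when s_j is minimal. *)
Lemma H_term_plocal (p t l : nat) (s : l.-tuple nat) (k : 'I_l -> nat)
    (j : 'I_l) (hp : prime p) :
    (forall i, 0 < k i < p ^ t.+1)%N -> coprime p (k j) ->
  (p ^ ((weight s - smin s) * t))%:R * \prod_(i < l) ((k i)%:R ^- tnth s i)
    \in plocal p.
Proof.
move=> kb pkj.
have -> : ((weight s - smin s) * t =
           (tnth s j - smin s) * t + \sum_(i < l | i != j) t * tnth s i)%N.
  rewrite -big_distrr /= [(t * _)%N]mulnC -mulnDl; congr (_ * _)%N.
  by rewrite /weight (bigD1 j) //= addnBAC // smin_le.
rewrite expnD natrM -mulrA rpredM ?rpred_nat //.
rewrite [X in _ * X](bigD1 j) //= mulrCA.
rewrite rpredM //; first by rewrite -exprVn rpredX // coprime_plocalV.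
rewrite expn_sum natr_prod -big_split /= rpred_prod // => i _.
by rewrite expnM natrX -exprVn -exprMn rpredX // pexp_div_plocal.
Qed.

(** Dividing by p is a bijection from the index tuples up to n with all
    entries divisible by p to the index tuples up to n %/ p. *)
Lemma H_divisible_part (p l n : nat) (s : l.-tuple nat) (hp : prime p) :
  \sum_(k : {ffun 'I_l -> 'I_n.+1} |
          ([forall i : 'I_l, (0 < k i)%N] &&
           [forall i : 'I_l, forall j : 'I_l, (i < j)%N ==> (k i < k j)%N])
          && [forall i : 'I_l, (p %| k i)%N])
    \prod_(i < l) ((k i)%:R ^- tnth s i : rat)
  = (p ^ weight s)%:R^-1 * H s (n %/ p).
Proof.
have p0 := prime_gt0 hp.
pose dil (k : {ffun 'I_l -> 'I_(n %/ p).+1}) : {ffun 'I_l -> 'I_n.+1} :=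
  [ffun i => inord (p * k i)].
pose und (k : {ffun 'I_l -> 'I_n.+1}) : {ffun 'I_l -> 'I_(n %/ p).+1} :=
  [ffun i => inord (k i %/ p)].
have dilE k i : dil k i = (p * k i)%N :> nat.
  rewrite ffunE inordK // ltnS (leq_trans _ (leq_trunc_div n p)) // mulnC.
  by rewrite leq_mul2r -ltnS ltn_ord orbT.
have undE k i : und k i = (k i %/ p)%N :> nat.
  by rewrite ffunE inordK // ltnS leq_div2r // -ltnS.
rewrite (reindex_onto dil und) => [|k /andP[_ /forallP pk]]; last first.
  by apply/ffunP => i; apply: val_inj; rewrite /= dilE undE mulnC divnK.
rewrite /H big_distrr /=; apply: eq_big => [k | k _].
  have -> : und (dil k) == k.
    by apply/eqP/ffunP => i; apply: val_inj; rewrite /= undE dilE mulKn.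
  have -> : [forall i, (p %| dil k i)%N].
    by apply/forallP => i; rewrite dilE dvdn_mulr.
  rewrite !andbT; congr (_ && _).
    by apply: eq_forallb => i; rewrite dilE muln_gt0 p0.
  apply: eq_forallb => i; apply: eq_forallb => j.
  by rewrite !dilE ltn_pmul2l.
rewrite /weight expn_sum natr_prod -prodfV -big_split /=.
by apply: eq_bigr => i _; rewrite dilE natrM natrX exprMn invfM.
Qed.

Lemma H_sub_quotient_plocal (p t l n : nat) (s : l.-tuple nat) (hp : prime p) :
    (n < p ^ t.+1)%N ->
  (p ^ ((weight s - smin s) * t))%:R *
    (H s n - (p ^ weight s)%:R^-1 * H s (n %/ p)) \in plocal p.
Proof.
move=> np; rewrite -(H_divisible_part p l n s hp) {1}/H.
rewrite (bigID (fun k : {ffun 'I_l -> 'I_n.+1} => [forall i, (p %| k i)%N])) /=.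
rewrite [X in X - _]addrC addrK big_distrr /= rpred_sum // => k.
rewrite negb_forall => /andP[/andP[/forallP k0 _] /existsP[j pkj]].
apply: (@H_term_plocal p t l s (fun i => k i) j hp) => [i|].
  by rewrite k0 (leq_trans _ np) // ltn_ord.
by rewrite prime_coprime.
Qed.

(** The exponents match because (W - m)(u + 1) - W = (W - m) u - m. *)
Lemma H_not_plocal_step (p u l n : nat) (s : l.-tuple nat) (hp : prime p) :
    (smin s <= weight s)%N -> (n < p ^ u.+2)%N ->
    (p ^ ((weight s - smin s) * u))%:R / (p ^ smin s)%:R * H s (n %/ p)
      \notin plocal p ->
  (p ^ ((weight s - smin s) * u.+1))%:R * H s n \notin plocal p.
Proof.
move=> mW np; apply: contra => Hn.
have := rpredB Hn (H_sub_quotient_plocal p u.+1 l n s hp np).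
rewrite mulrBr opprB addrC subrK mulrA.
set D := (weight s - smin s)%N.
have -> // : (p ^ (D * u.+1))%:R / (p ^ weight s)%:R
           = (p ^ (D * u))%:R / (p ^ smin s)%:R :> rat.
have pn c : ((p ^ c)%:R : rat) != 0.
  by rewrite pnatr_eq0 -lt0n expn_gt0 prime_gt0.
apply/eqP; rewrite eqr_div // -!natrM eqr_nat -!expnD mulnS.
by rewrite addnAC subnK // addnC.
Qed.

(** * Finiteness of the p-divisible set *)

Theorem theorem2p1 (l : nat) (hl : (2 <= l)%N) (p : nat) (hp : prime p)
    (t0 : nat) (ht0 : G p t0 l)
    (s : l.-tuple nat) (hs : forall i : 'I_l, (0 < tnth s i)%N)
    (htau : exists2 tau : nat, (t0 < tau)%N &
       ((((weight s)%:Z - (smin s)%:Z) * (tau%:Z - 1) - (smin s)%:Z)%:E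
          < f s p tau)%E) :
  finite_set (J s p).
Proof.
case: htau => -[//|v] _ hf.
have mW : (smin s <= weight s)%N.
  have j : 'I_l by exists 0%N; apply: leq_trans hl.
  exact: leq_trans (smin_le l s j) (tnth_le_weight l s j).
set D := (weight s - smin s)%N.
have base n : (p ^ v <= n < p ^ v.+1)%N ->
    (p ^ (D * v))%:R / (p ^ smin s)%:R * H s n \notin plocal p.
  move=> nG; apply/negP => /(plocal_vp_le _ _ _ _ hp); apply/negP.
  have /andP[_ np] := nG.
  rewrite -ltNge; move: hf; rewrite subzn // intS addrAC subrr add0r -PoszM.
  move=> /lt_le_trans; apply; rewrite /f.
  exact: (bigmin_le_cond (j := Ordinal np) +oo%E).
(* Dividing by p^m only makes a number less p-local, so the stronger failure
   obtained from one step of the recursion feeds the next one. *)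
have pD u n : (p ^ (D * u))%:R * H s n \notin plocal p ->
    (p ^ (D * u))%:R / (p ^ smin s)%:R * H s n \notin plocal p.
  apply: contra => Hn.
  have -> : (p ^ (D * u))%:R * H s n =
      (p ^ smin s)%:R * ((p ^ (D * u))%:R / (p ^ smin s)%:R * H s n).
    rewrite !mulrA [_%:R * _%:R]mulrC mulfK //.
    by rewrite pnatr_eq0 -lt0n expn_gt0 prime_gt0.
  by rewrite rpredM ?rpred_nat.
have levelP u n : (p ^ u.+1 <= n < p ^ u.+2)%N ->
    (p ^ u <= n %/ p < p ^ u.+1)%N.
  by move=> /andP[h1 h2]; rewrite leq_divRL ?ltn_divLR ?prime_gt0 // -!expnSr h1.
have level u : (v <= u)%N -> forall n, (p ^ u <= n < p ^ u.+1)%N ->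
    (p ^ (D * u))%:R / (p ^ smin s)%:R * H s n \notin plocal p.
  move=> /subnK <-; elim: (u - v)%N => [|w IH] n nG; first exact: base.
  rewrite addSn in nG *; apply/pD/H_not_plocal_step => //.
    by case/andP: nG.
  exact/IH/levelP.
apply: (@sub_finite_set _ _ `I_(p ^ v.+1)); last exact: finite_II.
move=> n [-> | [ln pa]] /=; first by rewrite expn_gt0 prime_gt0.
rewrite ltnNge; apply/negP => vn.
have n0 : (0 < n)%N by rewrite (leq_trans _ vn) // expn_gt0 prime_gt0.
have /andP[lo up] := trunc_log_bounds (prime_gt1 hp) n0.
have vt : (v < trunc_log p n)%N by rewrite trunc_log_max ?prime_gt1.
case: (trunc_log p n) vt lo up => // u vu lo up.
have /level/(_ (n %/ p)%N) : (v <= u)%N by [].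
rewrite levelP ?lo // => /(_ isT) /(H_not_plocal_step _ _ _ _ _ hp mW up).
move=> /negP; apply; rewrite rpredM ?rpred_nat //.
exact: coprime_dvdl pa (coprime_num_den (H s n)).
Qed.
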